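(* Let $M=\mathbb{R}/\mathbb{Z}$ with Lebesgue measure $m$, let $f_0:M\to M$ be a $C^2$ local diffeomorphism with a unique saddle-node fixed point $0$ ($f_0(0)=0$, $f_0'(0)=1$, $f_0''(0)>0$), let $B(\{0\})=\{x\in M: f_0^k(x)\to0 \text{ as } k\to\infty\}$, let $W_0$ be the connected component of $B(\{0\})$ containing $0$, and assume $|f_0'(x)|>1$ for all $x\in M\setminus W_0$. Then $m(M\setminus B(\{0\}))=0$. *)

(* Defs.v *)
(* The circle M = R/Z is handled through lifts:
   a map f0 : M -> M is represented by a lift F : R -> R with
   F (x + 1) = F x + d for an integer d (the degree). *)
From HB Require Import structures.
From mathcomp Require Import all_boot all_order all_algebra.
From mathcomp Require Import all_classical all_reals all_analysis.
Set Implicit Arguments. Unset Strict Implicit. Unset Printing Implicit Defensive.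
Import Order.TTheory GRing.Theory Num.Theory.
Import numFieldNormedType.Exports.
Local Open Scope classical_set_scope.
Local Open Scope ring_scope.

(* x is an integer, i.e. x projects to 0 in R/Z *)
Definition is_int {R : realType} (x : R) : Prop := exists n : int, x = n%:~R.

Definition circ_dist0 {R : realType} (x : R) : R :=
  Num.min (x - (Num.floor x)%:~R) ((Num.ceil x)%:~R - x).

Definition circle_lift {R : realType} (F : R -> R) : Prop :=
  exists d : int, forall x, F (x + 1) = F x + d%:~R.

Definition C2 {R : realType} (F : R -> R) : Prop :=
  (forall x, derivable F x 1) /\ (forall x, derivable (derive1 F) x 1) /\
  continuous (derive1n 2 F).

Definition basin0 {R : realType} (F : R -> R) : set R :=
  [set x | (fun k : nat => circ_dist0 (iter k F x)) @ \oo --> (0 : R)].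

(* lift of W_0, the connected component of B({0}) in M containing 0:
   the class of x lies in W_0 iff some lift y of it is joined to 0 by a
   segment lying in (the lift of) B({0}). *)
Definition W0 {R : realType} (F : R -> R) : set R :=
  [set x | exists n : int,
     let y := x + n%:~R in
     forall z, Num.min 0 y <= z <= Num.max 0 y -> basin0 F z].

(* Main.v *)
(** Normalise the lift to [G] with [G 0 = 0]. Either every point of [(-1, 0)]
    moves to the right under [G], and the basin is everything, or there is a
    last fixed point [p = q - 1] in [(-1, 0)]; then [W0] is [(p, 0]] modulo the
    integers and [G' > 1] on [(0, q]]. A point outside the basin never visits
    the gaps [(m + q, m + 1)], so it suffices to show that the closed set of
    points whose orbits avoid all gaps is null in [[0, q]].

    The backward orbit [xs] of [q] towards the neutral point [0] cuts [(0, q]]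
    into fundamental domains [[xs (j+1), xs j]]. First passage through the
    domain [[xs 1, q]], followed by one more step, is uniformly expanding, and
    its logarithmic derivative is uniformly Lipschitz in terms of the image
    point: the successive images of a fundamental domain are disjoint, which
    replaces the missing uniform expansion near [0]. Hence all intervals mapped
    onto a translate of [[0, q]] by iterated passages have bounded distortion
    and lose a fixed proportion to a gap, while the rest of each is covered, up
    to a null set, by smaller intervals of the same kind. The proportion of
    surviving points is therefore at most [(1 - c)^n] for every [n]. *)
Require Import Defs.
From HB Require Import structures.
From mathcomp Require Import all_boot all_order all_algebra.
From mathcomp Require Import all_classical all_reals all_analysis.
From mathcomp Require Import ring lra.
Set Implicit Arguments. Unset Strict Implicit. Unset Printing Implicit Defensive.
Import Order.TTheory GRing.Theory Num.Theory.
Import numFieldNormedType.Exports.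
Local Open Scope classical_set_scope.
Local Open Scope ring_scope.

(** * Iterates of an increasing lift and their derivatives *)

Section Iterates.
Variables (R : realType) (G g : R -> R).
Hypothesis dG : forall x : R, is_derive x 1 G (g x).
Hypothesis g_gt0 : forall x, 0 < g x.

(** The logarithm of the derivative of [iter n G], so that distortion becomes a difference of
    sums. *)
Definition logder n x := \sum_(i < n) ln (g (iter i G x)).

Lemma logderS n x : logder n.+1 x = ln (g x) + logder n (G x).
Proof.
rewrite /logder big_ord_recl /=; congr (_ + _).
by apply: eq_bigr => i _; rewrite -iterS iterSr.
Qed.

Lemma logderSr n x : logder n.+1 x = logder n x + ln (g (iter n G x)).
Proof. by rewrite /logder big_ord_recr. Qed.

Lemma logderD n k x : logder (n + k) x = logder n x + logder k (iter n G x).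
Proof.
elim: n x => [|n IH] x; first by rewrite [logder 0 _]big_ord0 add0r.
by rewrite addSn !logderS IH iterSr addrA.
Qed.

Lemma is_derive_iter n (x : R) : is_derive x 1 (iter n G) (expR (logder n x)).
Proof.
elim: n => [|n IH] /=.
  by rewrite /logder big_ord0 expR0; exact: is_derive_id.
rewrite logderSr expRD lnK ?posrE// mulrC.
by apply: is_derive1_comp; exact: dG.
Qed.

Lemma continuous_iter n : continuous (iter n G).
Proof.
move=> x; apply/differentiable_continuous/derivable1_diffP.
by have [] := is_derive_iter n x.
Qed.

Lemma iter_mvt n a b : a <= b ->
  exists2 c, a <= c <= b &
    iter n G b - iter n G a = expR (logder n c) * (b - a).
Proof.
move=> ab; have [c] := @MVT_segment _ (iter n G) (expR \o logder n) a b ab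
  (fun x _ => is_derive_iter n x) (continuous_subspaceT (@continuous_iter n)).
by rewrite in_itv/=; exists c.
Qed.

Lemma iter_mvt_norm n a b u v : a <= u <= b -> a <= v <= b ->
  exists2 c, a <= c <= b &
    `|iter n G u - iter n G v| = expR (logder n c) * `|u - v|.
Proof.
move=> /andP[au ub] /andP[av vb]; wlog vu : u v au ub av vb / v <= u.
  move=> H; have [/H|/ltW/H] := leP v u; first exact.
  by rewrite distrC [`|u - v|]distrC; exact.
have [c /andP[vc cu] ->] := iter_mvt n vu.
exists c; first by rewrite (le_trans av vc) (le_trans cu ub).
by rewrite normrM ger0_norm ?expR_ge0.
Qed.

Lemma lt_iter n : {mono iter n G : x y / x < y}.
Proof.
apply/leW_mono/le_mono => x y xy; rewrite -subr_gt0.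
have [c _ ->] := iter_mvt n (ltW xy).
by rewrite mulr_gt0 ?expR_gt0 ?subr_gt0.
Qed.

Lemma le_iter n : {mono iter n G : x y / x <= y}.
Proof.
apply: le_mono => x y; by rewrite lt_iter.
Qed.

Lemma iter_ivt n a b v : a <= b -> iter n G a <= v <= iter n G b ->
  exists2 c, a <= c <= b & iter n G c = v.
Proof.
move=> ab /andP[va vb].
have /(@IVT _ (iter n G) a b v ab
  (continuous_subspaceT (@continuous_iter n))) :
    Num.min (iter n G a) (iter n G b) <= v <= Num.max (iter n G a) (iter n G b).
  by rewrite min_l ?max_r ?le_iter// va.
by move=> [c]; rewrite in_itv/=; exists c.
Qed.

Variable d : int.
Hypothesis Gper : forall x, G (x + 1) = G x + d%:~R.

Lemma deriv_per x : g (x + 1) = g x.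
Proof.
have h1 : is_derive x 1 (fun y => G (y + 1)) (g (x + 1) * (1 + 0)).
  exact: (@is_derive1_comp _ G (fun y => y + 1)).
have h2 : is_derive x 1 (fun y => G (y + 1)) (g x + 0).
  have -> : (fun y => G (y + 1)) = G + cst d%:~R by apply/funext => y; exact: Gper.
  exact: is_deriveD.
have [_ e1] := h1; have [_ e2] := h2.
by move: e1; rewrite e2 !addr0 mulr1.
Qed.

Lemma deriv_int x (m : int) : g (x + m%:~R) = g x.
Proof.
have nat (n : nat) y : g (y + n%:~R) = g y.
  elim: n y => [|n IH] y; first by rewrite addr0.
  by rewrite intS intrD [1%:~R + _]addrC addrA deriv_per IH.
case: m => n; first exact: nat.
by rewrite NegzE mulrNz -[in RHS](subrK n.+1%:~R x) nat.
Qed.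

Lemma lift_int x (m : int) : G (x + m%:~R) = G x + (m * d)%:~R.
Proof.
have nat (n : nat) y : G (y + n%:~R) = G y + (n%:Z * d)%:~R.
  elim: n y => [|n IH] y; first by rewrite mul0r !addr0.
  by rewrite intS intrD [1%:~R + _]addrC addrA Gper IH -addrA -intrD mulrDl mul1r [d + _]addrC.
case: m => n; first exact: nat.
rewrite NegzE mulrNz mulNr mulrNz -[in RHS](subrK n.+1%:~R x) nat.
by rewrite addrK.
Qed.

Lemma iter_int n x (m : int) :
  iter n G (x + m%:~R) = iter n G x + (m * d ^+ n)%:~R.
Proof.
elim: n => [|n IH]; first by rewrite mulr1.
by rewrite /= IH lift_int exprSr mulrA.
Qed.

Lemma logder_int n x (m : int) : logder n (x + m%:~R) = logder n x.
Proof.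
by apply: eq_bigr => i _; rewrite iter_int deriv_int.
Qed.

End Iterates.

(** * Expansion and distortion of passages through fundamental domains *)

Section Distortion.
Variables (R : realType) (G g : R -> R).
Hypothesis dG : forall x : R, is_derive x 1 G (g x).
Hypothesis g_gt0 : forall x, 0 < g x.
Variables (q L kap : R) (xs : nat -> R).
Hypothesis xs0 : xs 0%N = q.
Hypothesis Gxs : forall j, G (xs j.+1) = xs j.
Hypothesis xs_gt0 : forall j, 0 < xs j.
Hypothesis xs_dec : forall j, xs j.+1 < xs j.
Hypothesis L_ge0 : 0 <= L.
Hypothesis g_ge1 : forall x, 0 <= x <= q -> 1 <= g x.
Hypothesis lng_lip : forall x y, 0 <= x <= q -> 0 <= y <= q ->
  `|ln (g x) - ln (g y)| <= L * `|x - y|.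
Hypothesis kap_g : forall x, xs 1%N <= x <= q -> 1 <= kap * g x.

Local Notation S := (logder G g).
Local Notation D0 := (L * expR (L * q) / (q - xs 1%N)).

Lemma xs_le_q j : xs j <= q.
Proof. by elim: j => [|j IH]; rewrite ?xs0// (le_trans (ltW (xs_dec j))). Qed.

Lemma fund_in j u : xs j.+1 <= u <= xs j -> 0 <= u <= q.
Proof.
move=> /andP[h1 h2].
by rewrite (le_trans (ltW (xs_gt0 _)) h1) (le_trans h2 (xs_le_q _)).
Qed.

Lemma fund_step j u :
  xs j.+2 <= u <= xs j.+1 -> xs j.+1 <= G u <= xs j.
Proof.
by move=> /andP[h1 h2]; rewrite -(Gxs j.+1) -(Gxs j) !(le_iter dG g_gt0 1) h1.
Qed.

Lemma fund_iter j u : xs j.+1 <= u <= xs j -> xs 1%N <= iter j G u <= q.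
Proof.
elim: j u => [|j IH] u; first by rewrite xs0.
by move=> /fund_step/IH; rewrite iterSr.
Qed.

Lemma expand_step u v : 0 <= u <= q -> 0 <= v <= q ->
  `|u - v| <= `|G u - G v|.
Proof.
move=> hu hv; have [c cq /= ->] := iter_mvt_norm dG g_gt0 1 hu hv.
rewrite ler_peMl// /logder big_ord1 lnK ?posrE//; exact: g_ge1.
Qed.

Lemma expand_fund j u v : xs j.+1 <= u <= xs j -> xs j.+1 <= v <= xs j ->
  `|u - v| <= `|iter j G u - iter j G v|.
Proof.
elim: j u v => [//|j IH] u v hu hv; rewrite !iterSr.
by apply: le_trans (IH _ _ (fund_step hu) (fund_step hv));
   apply: expand_step; apply: fund_in; eassumption.
Qed.

Lemma contract_last u v : xs 1%N <= u <= q -> xs 1%N <= v <= q ->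
  `|u - v| <= kap * `|G u - G v|.
Proof.
move=> hu hv; have [c cq /= ->] := iter_mvt_norm dG g_gt0 1 hu hv.
rewrite mulrA ler_peMl// /logder big_ord1 lnK ?posrE//; exact: kap_g.
Qed.

(** The first [j] steps are only known not to contract; the factor [kap] comes from the last step,
    which starts in [[xs 1, q]]. *)
Lemma expand_return j u v : xs j.+1 <= u <= xs j -> xs j.+1 <= v <= xs j ->
  `|u - v| <= kap * `|iter j.+1 G u - iter j.+1 G v|.
Proof.
move=> hu hv; apply: le_trans (expand_fund hu hv) _.
exact: contract_last (fund_iter hu) (fund_iter hv).
Qed.

(* The images of a fundamental domain are disjoint, so their lengths telescope. *)
Lemma fund_distortion j u v : xs j.+1 <= u <= xs j -> xs j.+1 <= v <= xs j ->
  S j u - S j v <= L * (xs 1%N - xs j.+1).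
Proof.
elim: j u v => [|j IH] u v hu hv.
  by rewrite /logder !big_ord0 !subrr mulr0.
have := IH _ _ (fund_step hu) (fund_step hv).
have := ler_norm (ln (g u) - ln (g v)).
have := lng_lip (fund_in hu) (fund_in hv).
have : L * `|u - v| <= L * (xs j.+1 - xs j.+2).
  apply: ler_wpM2l => //; rewrite ler_norml; move: hu hv; lra.
rewrite !logderS; lra.
Qed.

(** The mean value theorem, applied between [u] and [v] and on the whole domain, whose image is
    [[xs 1, q]], gives two derivatives that [fund_distortion] compares up to the factor
    [expR (L * q)]. *)
Lemma fund_length j u v : xs j.+1 <= u <= xs j -> xs j.+1 <= v <= xs j ->
  `|u - v| <= (xs j - xs j.+1) * (expR (L * q) / (q - xs 1%N)
     * `|iter j G u - iter j G v|).
Proof.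
move=> hu hv; have hx0 : xs j.+1 <= xs j.+1 <= xs j by rewrite lexx ltW.
have hx1 : xs j.+1 <= xs j <= xs j by rewrite lexx ltW.
have it k : iter k G (xs k) = q.
  by elim: k => [|k IH]; rewrite ?xs0// iterSr Gxs.
have it1 k : iter k G (xs k.+1) = xs 1%N.
  by elim: k => [//|k IH]; rewrite iterSr Gxs.
have q1 : xs 1%N < q by rewrite -xs0.
have [c hc ->] := iter_mvt_norm dG g_gt0 j hu hv.
have [e he] := iter_mvt_norm dG g_gt0 j hx1 hx0.
rewrite it it1 gtr0_norm ?subr_gt0// (gtr0_norm (_ : 0 < xs j - xs j.+1)) ?subr_gt0// => ->.
have dj : xs j - xs j.+1 != 0 by rewrite subr_eq0 gt_eqF.
have -> : (xs j - xs j.+1) * (expR (L * q) / (expR (S j e) * (xs j - xs j.+1))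
    * (expR (S j c) * `|u - v|)) = expR (L * q - S j e + S j c) * `|u - v|.
  by rewrite !expRD expRN; field; rewrite dj gt_eqF ?expR_gt0.
rewrite ler_peMl// -expR0 ler_expR.
have := fund_distortion he hc.
have : L * (xs 1%N - xs j.+1) <= L * q.
  by apply: ler_wpM2l => //; have := xs_gt0 j.+1; move: q1; lra.
lra.
Qed.

(** Each step costs [L] times the current distance, which [fund_length] bounds by the length of the
    current domain times the final distance. These lengths telescope, so the constant does not grow
    with [j]. *)
Lemma fund_logder_lip j u v :
  xs j.+1 <= u <= xs j -> xs j.+1 <= v <= xs j ->
  S j u - S j v <= (xs 1%N - xs j.+1) * (D0 * `|iter j G u - iter j G v|).
Proof.
elim: j u v => [|j IH] u v hu hv.
  by rewrite /logder !big_ord0 !subrr mul0r.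
have := IH _ _ (fund_step hu) (fund_step hv).
have := ler_norm (ln (g u) - ln (g v)).
have := lng_lip (fund_in hu) (fund_in hv).
have := ler_wpM2l L_ge0 (fund_length hu hv).
rewrite !logderS -!iterSr; set N := `|_|; set A := expR _ / _.
have -> : D0 = L * A by rewrite mulrA.
lra.
Qed.

Lemma D0_ge0 : 0 <= D0.
Proof. by rewrite divr_ge0 ?mulr_ge0 ?expR_ge0// subr_ge0 -[in leRHS]xs0 ltW. Qed.

(** The step out of [[xs 1, q]] adds [L]; as it does not contract, the distance before it may be
    replaced by the distance after it. *)
Lemma return_logder_lip j u v :
  xs j.+1 <= u <= xs j -> xs j.+1 <= v <= xs j ->
  S j.+1 u - S j.+1 v <=
    (q * D0 + L) * `|iter j.+1 G u - iter j.+1 G v|.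
Proof.
move=> hu hv; have D00 := D0_ge0; have q1 : xs 1%N < q by rewrite -[ltRHS]xs0.
have fu := fund_iter hu; have fv := fund_iter hv.
have inq w : xs 1%N <= w <= q -> 0 <= w <= q.
  by have := xs_gt0 1; lra.
have le1 := expand_step (inq _ fu) (inq _ fv).
have q0 : 0 <= q by have := xs_gt0 1; lra.
apply: (@le_trans _ _ ((q * D0 + L) * `|iter j G u - iter j G v|)); last first.
  by apply: ler_wpM2l => //; rewrite addr_ge0// mulr_ge0.
rewrite !logderSr.
have := fund_logder_lip hu hv.
have := ler_norm (ln (g (iter j G u)) - ln (g (iter j G v))).
have := lng_lip (inq _ fu) (inq _ fv).
have : (xs 1%N - xs j.+1) * (D0 * `|iter j G u - iter j G v|) <=
   q * (D0 * `|iter j G u - iter j G v|).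
  apply: ler_wpM2r; first by rewrite mulr_ge0.
  by have := xs_gt0 j.+1; lra.
lra.
Qed.

End Distortion.

(** * The surviving set has measure zero *)

Section Measure.
Variables (R : realType) (G g : R -> R).
Hypothesis dG : forall x : R, is_derive x 1 G (g x).
Hypothesis g_gt0 : forall x, 0 < g x.
Variables (dn : nat) (q kap D1 e1 : R) (xs : nat -> R).
Hypothesis Gper : forall x, G (x + 1) = G x + (dn.+2%:Z)%:~R.
Hypothesis q_gt0 : 0 < q.
Hypothesis Gq : G q = q + (dn.+1%:Z)%:~R.
Hypothesis xs0 : xs 0%N = q.
Hypothesis Gxs : forall j, G (xs j.+1) = xs j.
Hypothesis xs_gt0 : forall j, 0 < xs j.
Hypothesis xs_dec : forall j, xs j.+1 < xs j.
Hypothesis xs_cvg : forall e, 0 < e -> exists N, xs N.+1 < e.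
Hypothesis xs1e1 : xs 1%N < e1.
Hypothesis e1q : e1 < q.
Hypothesis Ge1 : G e1 = 1.
Hypothesis kap_lt1 : kap < 1.
Hypothesis D1_ge0 : 0 <= D1.
Hypothesis ret_expand : forall j u v,
  xs j.+1 <= u <= xs j -> xs j.+1 <= v <= xs j ->
  `|u - v| <= kap * `|iter j.+1 G u - iter j.+1 G v|.
Hypothesis ret_logder : forall j u v,
  xs j.+1 <= u <= xs j -> xs j.+1 <= v <= xs j ->
  logder G g j.+1 u - logder G g j.+1 v <=
    D1 * `|iter j.+1 G u - iter j.+1 G v|.

Local Notation S := (logder G g).
Local Notation d := (dn.+2%:Z).
Local Notation mu := (@lebesgue_measure R).

(** The intervals [(m + q, m + 1)] are the gaps. Avoiding these open sets at every time defines a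
    closed set, measurable without any appeal to the basin. *)
Definition survivors : set R :=
  [set x | forall n (m : int), ~ (m%:~R + q < iter n G x < m%:~R + 1)].

Local Notation Lam := survivors.
(* The fixed point of [D = D1 + kap * D]: a passage adds [D1] and contracts
   the previous Lipschitz constant by [kap]. *)
Local Notation D := (D1 / (1 - kap)).

(** A branch of iterated passages onto a translate of [[0, q]]. The last two clauses, no contraction
    and bounded distortion, carry constants independent of [n]. *)
Definition good a b n (m : int) := [/\ a <= b, iter n G a = m%:~R,
  iter n G b = m%:~R + q,
  (forall x y, a <= x <= b -> a <= y <= b ->
    `|x - y| <= `|iter n G x - iter n G y|) &
  (forall x y, a <= x <= b -> a <= y <= b ->
    S n x - S n y <= D * `|iter n G x - iter n G y|)].

Definition thin r s t := (mu (Lam `&` `[s, t]) <= (r * (t - s))%:E)%E.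

Lemma measurable_survivors : measurable Lam.
Proof.
have -> : Lam = ~` (\bigcup_(n in [set: nat]) \bigcup_(m in [set: int])
   (iter n G @^-1` `]m%:~R + q, m%:~R + 1[)).
  apply/seteqP; split => x /= H.
    by move=> [n _ [m _]] /=; rewrite in_itv/=; exact: H.
  by move=> n m h; apply: H; exists n => //; exists m => //=; rewrite in_itv.
apply: measurableC; apply: measurable_realfun.open_measurable.
apply: bigcup_open => n _; apply: bigcup_open => m _.
apply: open_comp; last exact: itv_open.
by move=> x _; apply: continuous_iter.
Qed.

Lemma measurable_survivors_itv s t : measurable (Lam `&` `[s, t]).
Proof. by apply: measurableI => //; exact: measurable_survivors. Qed.

Lemma measure_le_length s t : s <= t ->
  (mu (Lam `&` `[s, t]) <= (t - s)%:E)%E.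
Proof.
move=> st; apply: (@le_trans _ _ (mu `[s, t])).
  apply: le_measure; rewrite ?inE//; exact: measurable_survivors_itv.
rewrite lebesgue_measure_itv/= lte_fin; case: ifPn => //= _.
by rewrite lee_fin subr_ge0.
Qed.

Lemma measure_cat s t u : s <= t <= u ->
  (mu (Lam `&` `[s, u]) <= mu (Lam `&` `[s, t]) + mu (Lam `&` `[t, u]))%E.
Proof.
move=> /andP[st tu]; apply: le_trans (measureU2 _ _ _);
  [|exact: measurable_survivors_itv..].
apply: le_measure; rewrite ?inE//; first exact: measurable_survivors_itv.
  by apply: measurableU; exact: measurable_survivors_itv.
move=> x [Lx] /=; rewrite !in_itv/= => /andP[sx xu].
by have [xt|/ltW tx] := leP x t; [left|right]; split => //=; rewrite ?in_itv/= ?sx ?tx ?xt ?xu.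
Qed.

Lemma thin_cat r s t u : s <= t <= u -> thin r s t -> thin r t u -> thin r s u.
Proof.
move=> stu h1 h2; apply: le_trans (measure_cat stu) _.
by apply: le_trans (leeD h1 h2) _; rewrite -EFinD lee_fin; lra.
Qed.

Lemma measure_gap s t n (m : int) :
  iter n G s = m%:~R + q -> iter n G t = m%:~R + 1 ->
  mu (Lam `&` `[s, t]) = 0%E.
Proof.
move=> hs ht; apply/eqP; rewrite eq_le measure_ge0 andbT.
have ms := @measurable_set1 R; have m12 := measurableU _ _ (ms s) (ms t).
apply: (@le_trans _ _ (mu ([set s] `|` [set t]))).
  apply: le_measure; rewrite ?inE//; first exact: measurable_survivors_itv.
  move=> x [Lx] /=; rewrite in_itv/= !le_eqVlt.
  move=> /andP[/orP[/eqP->|sx]]; first by left.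
  move=> /orP[/eqP->|xt]; first by right.
  by case: (Lx n m); rewrite -hs -ht !lt_iter// sx.
have : (mu ([set s] `|` [set t]) <= mu [set s] + mu [set t])%E.
  exact: measureU2.
by rewrite !lebesgue_measure_set1 adde0.
Qed.

Lemma thin_gap r s t n (m : int) : 0 <= r -> s <= t ->
  iter n G s = m%:~R + q -> iter n G t = m%:~R + 1 -> thin r s t.
Proof.
move=> r0 st hs ht; rewrite /thin (measure_gap hs ht) lee_fin.
by rewrite mulr_ge0// subr_ge0.
Qed.

Lemma iter_split j n z (m : int) :
  iter (j + n) G z = iter j G (iter n G z - m%:~R) + (m * d ^+ j)%:~R.
Proof. by rewrite -(iter_int Gper) subrK iterD. Qed.

(** For one more passage, [ret_expand] reduces the inherited Lipschitz constant to [kap * D],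
    [ret_logder] adds [D1], and the sum is again [D]. *)
Lemma good_child a b n m j s t (M : int) : good a b n m ->
  a <= s -> s <= t -> t <= b ->
  m%:~R + xs j.+1 <= iter n G s -> iter n G t <= m%:~R + xs j ->
  iter (j.+1 + n) G s = M%:~R -> iter (j.+1 + n) G t = M%:~R + q ->
  good s t (j.+1 + n) M.
Proof.
move=> [ab Ga Gb hexp hlog] as_ st tb hs ht Hs Ht.
have inI z : s <= z <= t -> xs j.+1 <= iter n G z - m%:~R <= xs j.
  move=> /andP[sz zt].
  have h1 : iter n G s <= iter n G z by rewrite le_iter.
  have h2 : iter n G z <= iter n G t by rewrite le_iter.
  move: hs ht h1 h2; lra.
have inab z : s <= z <= t -> a <= z <= b by move: as_ tb; lra.
have sub2 (x y z : R) : x + z - (y + z) = x - y by ring.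
have k1 : 0 < 1 - kap by rewrite subr_gt0.
have Dge0 : 0 <= D by rewrite divr_ge0// ltW.
have dist x y : s <= x <= t -> s <= y <= t ->
    `|iter n G x - iter n G y| <=
    kap * `|iter (j.+1 + n) G x - iter (j.+1 + n) G y|.
  move=> hx hy; have := ret_expand (inI _ hx) (inI _ hy).
  rewrite !(iter_split _ _ _ m).
  by rewrite !sub2.
split => // x y hx hy.
  apply: le_trans (hexp _ _ (inab _ hx) (inab _ hy)) _.
  by apply: le_trans (dist _ _ hx hy) _; rewrite ler_piMl// ltW.
have := hlog _ _ (inab _ hx) (inab _ hy).
have := ler_wpM2l Dge0 (dist _ _ hx hy).
have := ret_logder (inI _ hx) (inI _ hy).
have Sint z : S j.+1 (iter n G z - m%:~R) = S j.+1 (iter n G z).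
  by rewrite -[in RHS](subrK m%:~R (iter n G z)) (logder_int dG Gper).
rewrite addnC !logderD !Sint addnC !(iter_split _ _ _ m) !sub2.
set N := `|_|; set N' := `|_|.
have -> : D * (kap * N) = D * N - D1 * N.
  by field; rewrite gt_eqF.
lra.
Qed.

Lemma q_lt1 : q < 1.
Proof. by rewrite -Ge1 -xs0 -Gxs (lt_iter dG g_gt0 1). Qed.

(** The image of [[s, t]] consists of [k] periods, each a gap followed by a translate of [[0, q]].
    The gap is null and the rest comes from a good interval; induction on [k] glues the pieces. *)
Lemma thin_fund r a b n m j s t (M : int) (k : nat) : 0 <= r ->
  (forall a b n m, good a b n m -> thin r a b) -> good a b n m ->
  a <= s -> t <= b ->
  m%:~R + xs j.+1 <= iter n G s -> iter n G t <= m%:~R + xs j ->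
  iter (j.+1 + n) G s = M%:~R + q -> iter (j.+1 + n) G t = M%:~R + k%:~R + q ->
  thin r s t.
Proof.
move=> r0 H gab as_ tb hs ht Hs; have q1 := q_lt1; have q0 := q_gt0.
have lei x y : x <= y -> iter n G x <= iter n G y by rewrite le_iter.
elim: k t tb ht => [|k IH] t tb ht Ht.
  have -> : t = s.
    by apply: (inc_inj (le_iter dG g_gt0 (j.+1 + n))); rewrite Hs Ht addr0.
  by have := measure_le_length (lexx s); rewrite /thin subrr mulr0.
have k0 : 0 <= k%:~R :> R by rewrite ler0z.
move: Ht; rewrite intS intrD => Ht.
have st : s <= t by rewrite -(le_iter dG g_gt0 (j.+1 + n)) Hs Ht; lra.
have [s1 /andP[ss1 s1t] Hs1] : exists2 c, s <= c <= t &
    iter (j.+1 + n) G c = M%:~R + k%:~R + q.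
  by apply: iter_ivt => //; rewrite Hs Ht; lra.
have [s2 /andP[s12 s2t] Hs2] : exists2 c, s1 <= c <= t &
    iter (j.+1 + n) G c = M%:~R + k%:~R + 1.
  by apply: iter_ivt => //; rewrite Hs1 Ht; move: q1 q_gt0; lra.
have ht1 := le_trans (lei _ _ s1t) ht; have tb1 := le_trans s1t tb.
apply: (thin_cat _ (IH _ tb1 ht1 Hs1)); first by rewrite ss1.
apply: (@thin_cat _ _ s2); first by rewrite s12.
  apply: (thin_gap (n := j.+1 + n) (m := M + k%:Z)) => //.
    by rewrite intrD.
  by rewrite intrD.
have ss2 := le_trans ss1 s12.
apply: H; apply: (@good_child a b n m j _ _ (M + k%:Z + 1)) => //.
- exact: le_trans as_ ss2.
- exact: le_trans hs (lei _ _ ss2).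
- by rewrite !intrD.
- by rewrite Ht !intrD; lra.
Qed.

Lemma iter_xs j : iter j G (xs j) = q.
Proof. by elim: j => [|j IH]; rewrite ?xs0// iterSr Gxs. Qed.

(* A lower bound for the proportion of a good interval taken by the preimage of
   the gap [(q, 1)]. *)
Local Notation c0 := ((e1 - xs 1%N) / q * expR (- (D * q))).

Lemma c0_bounds : 0 < c0 <= 1.
Proof.
have x10 := xs_gt0 1.
have h1 : 0 < e1 - xs 1%N by rewrite subr_gt0.
rewrite mulr_gt0 ?expR_gt0 ?divr_gt0//=.
rewrite mulr_ile1 ?expR_ge0 ?divr_ge0 ?(ltW q_gt0) ?(ltW h1)//.
  by rewrite ler_pdivrMr// mul1r; move: e1q; lra.
rewrite -[leRHS]expR0 ler_expR oppr_le0 mulr_ge0 ?(ltW q_gt0)// divr_ge0//.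
by rewrite subr_ge0 ltW.
Qed.

(** The images of [[c1, e]] and [[a, b]] have lengths [e1 - xs 1] and [q]. The derivatives at the
    two mean value points compare up to [expR (D * q)], since both image points lie in one translate
    of [[0, q]]. *)
Lemma gap_proportion a b n m c1 e : good a b n m ->
  a <= c1 <= b -> a <= e <= b ->
  iter n G c1 = m%:~R + xs 1%N -> iter n G e = m%:~R + e1 ->
  c0 * (b - a) <= e - c1.
Proof.
move=> [ab Ga Gb hexp hlog] /andP[ac1 c1b] /andP[ae eb] Hc1 He.
have c1e : c1 <= e by rewrite -(le_iter dG g_gt0 n) Hc1 He lerD2l ltW.
have [x /andP[cx xe]] := iter_mvt dG g_gt0 n c1e.
have [y hy] := iter_mvt dG g_gt0 n ab.
rewrite He Hc1 Ga Gb opprD addrACA subrr add0r addrAC subrr add0r => qe ee.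
have hx : a <= x <= b by rewrite (le_trans ac1 cx) (le_trans xe eb).
have Sxy : S n x - S n y <= D * q.
  apply: le_trans (hlog _ _ hx hy) _.
  apply: ler_wpM2l; first by rewrite divr_ge0// subr_ge0 ltW.
  move: hx hy => /andP[ax xb] /andP[ay yb].
  have /andP[? ?] : m%:~R <= iter n G x <= m%:~R + q by rewrite -Gb -Ga !le_iter// ax.
  have /andP[? ?] : m%:~R <= iter n G y <= m%:~R + q by rewrite -Gb -Ga !le_iter// ay.
  rewrite ler_norml; lra.
have E0 : 0 < expR (S n x) by exact: expR_gt0.
rewrite -(ler_pM2l E0) ee.
have -> : expR (S n x) * ((expR (S n x) * (e - c1)) / q * expR (- (D * q)) * (b - a)) =
  expR (S n x) * (e - c1) * ((expR (S n x - S n y - D * q)) * (expR (S n y) * (b - a) / q)).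
  by rewrite !expRD !expRN; field; rewrite !gt_eqF ?expR_gt0.
rewrite -qe divff ?gt_eqF// mulr1 ler_piMr//.
  by rewrite mulr_ge0 ?subr_ge0 ?expR_ge0.
by rewrite -[leRHS]expR0 ler_expR; move: Sxy; lra.
Qed.

(** Cut [[a, b]] at [c], [c1] and [e]: [[a, c]] is arbitrarily short, [[c, c1]] is a finite union of
    pulled-back fundamental domains, and [[c1, e]], a proportion at least [c0], is lost to a gap.
    Both [[c, c1]] and [[e, b]] are thin. *)
Lemma thin_contract r : 0 <= r ->
  (forall a b n m, good a b n m -> thin r a b) ->
  forall a b n m, good a b n m -> thin (r * (1 - c0)) a b.
Proof.
move=> r0 H a b n m gab; have [ab Ga Gb hexp _] := gab; have q1 := q_lt1; have q0 := q_gt0.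
have xs1 : xs 1%N < q by rewrite -[ltRHS]xs0.
have x10 := xs_gt0 1.
have ivt v s t : 0 <= v -> s <= t -> iter n G s <= m%:~R + v ->
    m%:~R + v <= iter n G t ->
    exists2 c, s <= c <= t & iter n G c = m%:~R + v.
  by move=> v0 st h1 h2; apply: iter_ivt => //; rewrite h1.
have [c1 /andP[ac1 c1b] Hc1] : exists2 c, a <= c <= b & iter n G c = m%:~R + xs 1%N.
  by apply: ivt; rewrite ?Ga ?Gb//; lra.
have [e /andP[c1e eb] He] : exists2 c, c1 <= c <= b & iter n G c = m%:~R + e1.
  by apply: ivt; rewrite ?Hc1 ?Gb//; move: xs1e1 e1q; lra.
have ae := le_trans ac1 c1e.
have gapl : c0 * (b - a) <= e - c1.
  by apply: (gap_proportion gab) => //; [rewrite ac1|rewrite ae].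
have iterS_m z v : iter n G z = m%:~R + v ->
    forall j, iter (j + n) G z = iter j G v + (m * d ^+ j)%:~R.
  by move=> hz j; rewrite (iter_split _ _ _ m) hz addrAC subrr add0r.
(* Together with [fund_bot]: the passage maps a fundamental domain onto exactly [dn.+1] periods,
   each beginning with a gap. *)
have fund_top j z : iter n G z = m%:~R + xs j ->
    iter (j.+1 + n) G z = (m * d ^+ j.+1)%:~R + dn.+1%:~R + q.
  by move=> /iterS_m ->; rewrite iterS iter_xs Gq; lra.
have fund_bot j z : iter n G z = m%:~R + xs j.+1 ->
    iter (j.+1 + n) G z = (m * d ^+ j.+1)%:~R + q.
  by move=> /iterS_m ->; rewrite iter_xs addrC.
(* Induction outwards from [c1]: each stage adds the next domain towards the neutral end [a]. *)
have tail N c : a <= c <= b -> iter n G c = m%:~R + xs N.+1 -> thin r c c1.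
  elim: N c => [|N IH] c /andP[ac cb] Hc.
    have -> : c = c1.
      by apply: (inc_inj (le_iter dG g_gt0 n)); rewrite Hc Hc1.
    by have := measure_le_length (lexx c1); rewrite /thin subrr mulr0.
  have xN := xs_dec N.+1; have xN0 := xs_gt0 N.+1.
  have [c' /andP[cc' c'b] Hc'] : exists2 c', c <= c' <= b &
      iter n G c' = m%:~R + xs N.+1.
    have xNq := xs_le_q xs0 xs_dec N.+1.
    by apply: ivt; rewrite ?Hc ?Gb//; lra.
  have c'c1 : c' <= c1.
    rewrite -(le_iter dG g_gt0 n) Hc1 Hc' lerD2l.
    elim: (N) => [//|k]; apply: le_trans; exact/ltW/xs_dec.
  apply: (@thin_cat _ _ c'); first by rewrite cc'.
    apply: (thin_fund r0 H gab ac c'b _ _ (fund_bot _ _ Hc) (fund_top _ _ Hc')).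
      by rewrite Hc.
    by rewrite Hc'.
  by apply: IH => //; rewrite (le_trans ac cc').
have Gb0 : iter n G b = m%:~R + xs 0%N by rewrite xs0.
(* One step later the image of [[e, b]] starts at an integer, with no gap in front, so a good
   interval [[e, t]] is split off first and [dn] full periods remain. *)
have eb_thin : thin r e b.
  have He' : iter (1 + n) G e = (m * d + 1)%:~R.
    by rewrite (iterS_m _ _ He 1) /= Ge1 expr1 intrD addrC.
  have dn0 : 0 <= dn%:~R :> R by rewrite ler0z.
  have Hb' := fund_top 0%N b Gb0.
  have dn1 : dn.+1%:~R = 1 + dn%:~R :> R by rewrite intS intrD.
  rewrite expr1 dn1 in Hb'.
  have [t /andP[et tb] Ht] : exists2 t, e <= t <= b &
      iter (1 + n) G t = (m * d + 1)%:~R + q.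
    apply: iter_ivt => //; rewrite He' Hb' intrD; move: q_gt0 dn0; lra.
  have let_ := et; rewrite -(le_iter dG g_gt0 n) in let_.
  have letb := tb; rewrite -(le_iter dG g_gt0 n) in letb.
  apply: (@thin_cat _ _ t); first by rewrite et.
    apply: H; apply: (good_child (j := 0) gab ae et tb _ _ He' Ht).
      by rewrite He lerD2l ltW.
    by rewrite -Gb0.
  apply: (thin_fund (j := 0) (k := dn) r0 H gab _ (lexx b) _ _ Ht).
  - exact: le_trans ae et.
  - by apply: le_trans let_; rewrite He lerD2l ltW.
  - by rewrite Gb0.
  - by rewrite Hb' intrD; lra.
have gap0 : mu (Lam `&` `[c1, e]) = 0%E.
  apply: (@measure_gap _ _ (1 + n) (m * d)).
    by rewrite (fund_bot 0%N _ Hc1) expr1.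
  by rewrite (iterS_m _ _ He 1) /= Ge1 expr1 addrC.
(* The domains accumulate at [a] without reaching it. As [iter n G] does not contract on [[a, b]],
   the remainder [[a, c]] is no longer than [xs N.+1 < eps]. *)
apply/lee_addgt0Pr => eps eps0.
have [N xN] := xs_cvg eps0.
have xN0 := xs_gt0 N.+1; have xNq := xs_le_q xs0 xs_dec N.+1.
have [c /andP[ac cb] Hc] : exists2 c, a <= c <= b & iter n G c = m%:~R + xs N.+1.
  by apply: ivt; rewrite ?Ga ?Gb//; lra.
have cc1 : c <= c1.
  rewrite -(le_iter dG g_gt0 n) Hc1 Hc lerD2l.
  elim: (N) => [//|k]; apply: le_trans; exact/ltW/xs_dec.
have cla : c - a <= eps.
  have := hexp c a; rewrite ac cb ab lexx => /(_ isT isT).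
  rewrite Hc Ga addrAC subrr add0r ger0_norm ?subr_ge0// gtr0_norm//.
  by move: xN; lra.
have Hcc1 : thin r c c1 by apply: (tail N) => //; rewrite ac.
have m1 : (mu (Lam `&` `[a, b]) <= mu (Lam `&` `[a, c]) + mu (Lam `&` `[c, b]))%E.
  by apply: measure_cat; rewrite ac.
have m2 : (mu (Lam `&` `[c, b]) <= mu (Lam `&` `[c, c1]) + mu (Lam `&` `[c1, b]))%E.
  by apply: measure_cat; rewrite cc1.
have m3 : (mu (Lam `&` `[c1, b]) <= mu (Lam `&` `[e, b]))%E.
  have := @measure_cat c1 e b; rewrite gap0 add0e; apply; by rewrite c1e.
apply: (le_trans m1).
apply: (@le_trans _ _ ((c - a)%:E + ((r * (c1 - c))%:E + (r * (b - e))%:E))%E).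
  apply: leeD; first exact: measure_le_length.
  apply: (le_trans m2); apply: leeD => //.
  exact: le_trans m3 _.
rewrite -!EFinD lee_fin.
have := ler_wpM2l r0 gapl; have := mulr_ge0 r0 (_ : 0 <= c - a); rewrite subr_ge0 => /(_ ac).
move: cla; set C0 := c0; lra.
Qed.

(** [[0, q]] is itself good for zero iterates, so [thin_contract] can be iterated from the trivial
    proportion 1. *)
Lemma measure_survivors : mu (Lam `&` `[0, q]) = 0%E.
Proof.
have /andP[c00 c01] := c0_bounds.
have Hn k a b n m : good a b n m -> thin ((1 - c0) ^+ k) a b.
  elim: k a b n m => [|k IH] a b n m gab.
    by rewrite /thin expr0 mul1r; apply: measure_le_length; case: gab.
  rewrite exprSr; apply: (thin_contract _ IH gab).
  by rewrite exprn_ge0// subr_ge0.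
have g0q : good 0 q 0 0.
  split => //; first exact: ltW.
    by rewrite add0r.
  by move=> x y _ _; rewrite /logder !big_ord0 subrr mulr_ge0 ?divr_ge0 ?subr_ge0// ltW.
apply/eqP; rewrite eq_le measure_ge0 andbT.
apply/lee_addgt0Pr => eps eps0; rewrite add0e.
have cv : (fun k => (1 - c0) ^+ k) @ \oo --> (0 : R).
  apply: cvg_expr; rewrite ger0_norm ?subr_ge0//; move: c00; set C0 := c0; lra.
have : 0 < eps / q by rewrite divr_gt0.
move/cvgrPdist_lt : cv => /[apply] -[N _ /(_ N (leqnn N))] /=.
rewrite sub0r normrN ger0_norm; last by rewrite exprn_ge0// subr_ge0.
rewrite ltr_pdivlMr// => hN.
apply: (le_trans (Hn N _ _ _ _ g0q)).
by rewrite lee_fin subr0 ltW.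
Qed.

End Measure.

(** * Distance to the nearest integer *)

Section CircleDistance.
Variable R : realType.
Implicit Types (x : R) (m : int).

Lemma circ_dist0_int x m : circ_dist0 (x + m%:~R) = circ_dist0 x.
Proof.
rewrite /circ_dist0; have -> : Num.floor (x + m%:~R) = Num.floor x + m.
  by apply: floor_def; have := floor_itv x; rewrite !intrD; lra.
have -> : Num.ceil (x + m%:~R) = Num.ceil x + m.
  by apply: ceil_def; have := ceil_itv x; rewrite !intrD; lra.
by rewrite !intrD; congr Num.min; ring.
Qed.

Lemma circ_dist0_ge0 x : 0 <= circ_dist0 x.
Proof. by rewrite /circ_dist0 le_min !subr_ge0 floor_le ceil_ge. Qed.

Lemma circ_dist0_le_opp x : x <= 0 -> circ_dist0 x <= - x.
Proof.
move=> x0; rewrite /circ_dist0 ge_min; apply/orP; right.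
by rewrite gerDr lerz0 ceil_le0.
Qed.

Lemma circ_dist0_01 x : 0 < x < 1 -> circ_dist0 x = Num.min x (1 - x).
Proof.
move=> /andP[x0 x1]; rewrite /circ_dist0.
have -> : Num.floor x = 0 by apply: floor_def; rewrite add0r (ltW x0) x1.
have -> : Num.ceil x = 1 by apply: ceil_def; rewrite subrr x0 (ltW x1).
by rewrite subr0.
Qed.

End CircleDistance.

(** * The basin on either side of the neutral point *)

Section Basin.
Variables (R : realType) (G g : R -> R).
Hypothesis dG : forall x : R, is_derive x 1 G (g x).
Hypothesis g_gt0 : forall x, 0 < g x.
Variable d : int.
Hypothesis Gper : forall x, G (x + 1) = G x + d%:~R.

Lemma basin0_step x : basin0 G (G x) <-> basin0 G x.
Proof.
rewrite /basin0/= -(cvg_shiftS (fun k => circ_dist0 (iter k G x))).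
by under [in X in _ <-> X]eq_fun do rewrite iterSr.
Qed.

Lemma basin0_iter n x : basin0 G (iter n G x) <-> basin0 G x.
Proof. by elim: n => [//|n IH]; rewrite iterS basin0_step. Qed.

Lemma basin0_int x (m : int) : basin0 G (x + m%:~R) <-> basin0 G x.
Proof.
rewrite /basin0/=.
by under eq_fun do rewrite (iter_int Gper) circ_dist0_int.
Qed.

(** Permits normalising the lift to fix 0: orbits under the two lifts differ by integers. *)
Lemma basin0_translate (m : int) : basin0 (fun x => G x + m%:~R) = basin0 G.
Proof.
have H k x : exists n : int,
    iter k (fun x => G x + m%:~R) x = iter k G x + n%:~R.
  elim: k => [|k [n IH]]; first by exists 0; rewrite addr0.
  by exists (n * d + m); rewrite /= IH (lift_int Gper) intrD addrA.
apply/funext => x; rewrite /basin0/=.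
rewrite (_ : (fun k => circ_dist0 (iter k (fun x => G x + m%:~R) x)) =
  (fun k => circ_dist0 (iter k G x)))//.
by apply/funext => k; have [n ->] := H k x; rewrite circ_dist0_int.
Qed.

Lemma fixed_not_basin0 x (m : int) : 0 < x < 1 -> G x = x + m%:~R ->
  ~ basin0 G x.
Proof.
move=> x01 Gx.
have H k : exists n : int, iter k G x = x + n%:~R.
  elim: k => [|k [n IH]]; first by exists 0; rewrite addr0.
  by exists (m + n * d); rewrite /= IH (lift_int Gper) Gx intrD addrA.
rewrite /basin0/=.
have -> : (fun k => circ_dist0 (iter k G x)) = cst (Num.min x (1 - x)).
  by apply/funext => k; have [n ->] := H k; rewrite circ_dist0_int circ_dist0_01.
move/(cvg_unique (@norm_hausdorff _ _) (cvg_cst _)) => /eqP.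
rewrite /= gt_eqF// lt_min; move: x01; lra.
Qed.

Lemma lim_fixed (u : nat -> R) l : u @ \oo --> l ->
  (forall k, u k.+1 = G (u k)) \/ (forall k, u k = G (u k.+1)) -> G l = l.
Proof.
move=> ul H; have Gl : (G \o u) @ \oo --> G l.
  by apply: continuous_cvg => //; exact: (@continuous_iter _ _ _ dG g_gt0 1).
have uS : (fun k => u k.+1) @ \oo --> l by rewrite (cvg_shiftS u).
case: H => H.
  apply: (cvg_unique (@norm_hausdorff _ _) Gl).
  by rewrite (_ : G \o u = fun k => u k.+1)//; apply/funext => k; rewrite H.
have GlS : (fun k => (G \o u) k.+1) @ \oo --> G l by rewrite (cvg_shiftS (G \o u)).
apply: (cvg_unique (@norm_hausdorff _ _) GlS).
by rewrite (_ : (fun k => (G \o u) k.+1) = u)//; apply/funext => k; rewrite [RHS]H.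
Qed.

(** The orbit increases below 0, so it converges to a fixed point in [(p, 0]], which can only be
    0. *)
Lemma left_basin0 p x : G 0 = 0 -> (forall y, p < y < 0 -> y < G y) ->
  p < x <= 0 -> basin0 G x.
Proof.
move=> G0 Gy /andP[px x0]; set u := fun k => iter k G x.
have u0 k : p < u k <= 0.
  elim: k => [|k /andP[pu u0]]; first by rewrite /u/= px.
  have leG : u k.+1 <= 0 by rewrite -[leRHS]G0 /u/= (le_iter dG g_gt0 1).
  rewrite leG andbT; move: u0; rewrite le_eqVlt => /orP[/eqP u0|u0].
    by rewrite /u /= -/(u k) u0 G0 -u0.
  by apply: (lt_trans pu); rewrite Gy// pu.
have uinc : {homo u : n m / (n <= m)%N >-> n <= m}.
  apply/nondecreasing_seqP => k; rewrite /u/= -/(u k).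
  have /andP[pu] := u0 k; case: ltgtP => // uk0 _; last by rewrite uk0 G0.
  by rewrite ltW// Gy// pu.
have ub : has_ubound (range u).
  by exists 0 => _ [k _ <-]; have /andP[] := u0 k.
have ul := nondecreasing_cvgn uinc ub.
set l := sup _ in ul.
have l0 : l <= 0.
  by apply: ge_sup => [|_ [k _ <-]]; [exists (u 0%N), 0%N|have /andP[] := u0 k].
have xl : x <= l by apply: ub_le_sup => //; exists 0%N.
have Gl : G l = l by apply: (lim_fixed ul); left.
have {}l0 : l = 0.
  apply/eqP; rewrite eq_le l0 leNgt; apply/negP => l0'.
  by have := Gy l; rewrite Gl ltxx l0' (lt_le_trans px xl) => /(_ isT).
rewrite l0 in ul.
apply: (@squeeze_cvgr _ _ _ _ (cst 0) (fun k => - u k)).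
- apply: nearW => k; rewrite circ_dist0_ge0/= circ_dist0_le_opp//.
  by have /andP[] := u0 k.
- exact: cvg_cst.
- by rewrite -oppr0; exact: cvgN.
Qed.

(** Were [[0, x]] in the basin, so would be its images [[0, iter k G x]], and the orbit could never
    reach [q]. It would then tend to 0 from the right, where points are pushed away from 0. *)
Lemma right_not_W0 q x del (m : int) : 0 < q < 1 -> G q = q + m%:~R ->
  G 0 = 0 -> 0 < del -> (forall y, 0 < y < del -> y < G y) ->
  0 < x <= q -> ~ W0 G x.
Proof.
move=> q01 Gq G0 del0 Gy /andP[x0 xq] [n] /= H.
have qB := fixed_not_basin0 q01 Gq; have /andP[q0 q1] := q01.
(* A segment from 0 to [x + n] with [n] nonzero contains [q - 1] or [q], so only [n = 0] remains. *)
have [n1|n1|n0] := ltgtP n 0.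
- have {n1}n1 : n%:~R <= -1 :> R by rewrite (_ : -1 = (-1)%:~R)// ler_int -ltzD1 addNr.
  apply: qB; apply/(basin0_int _ (-1)); apply: H.
  rewrite min_r ?max_l; lra.
- have {n1}n1 : 1 <= n%:~R :> R by rewrite (_ : 1 = 1%:~R)// ler_int -gtz0_ge1.
  by apply: qB; apply: H; rewrite min_l ?max_r; lra.
have {H n0}H : forall z, 0 <= z <= x -> basin0 G z.
  by move=> z hz; apply: H; rewrite n0 addr0 min_l ?max_r ?(ltW x0).
have Hn k : 0 < iter k G x < q /\ forall z, 0 <= z <= iter k G x -> basin0 G z.
  have xk0 : 0 < iter k G x.
    elim: k => [//|k IH]; rewrite /= -G0; by rewrite (lt_iter dG g_gt0 1).
  suff HB : forall z, 0 <= z <= iter k G x -> basin0 G z.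
    split => //; rewrite xk0 ltNge; apply/negP => qx.
    by apply: qB; apply: HB; rewrite (ltW q0).
  elim: k {xk0} => [//|k IH] z /andP[z0 zx].
  have [w wx <-] : exists2 w, 0 <= w <= x & iter k.+1 G w = z.
    apply: (iter_ivt dG g_gt0 (ltW x0)); rewrite zx andbT.
    by suff -> : iter k.+1 G 0 = 0 by []; elim: (k.+1) => //= i ->.
  by apply/basin0_iter; exact: H.
have cv : basin0 G x by apply: H; rewrite (ltW x0) lexx.
(* The bound [1 - q] rules out closeness to 1, as the orbit stays below [q]. *)
have : 0 < Num.min del (1 - q) by rewrite lt_min del0 subr_gt0.
move/cvgrPdist_lt : (cv) => /[apply] -[N _ HN].
have small k : (N <= k)%N -> iter k G x < del.
  move=> /HN /=; have /andP[xk xkq] := (Hn k).1.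
  rewrite sub0r normrN ger0_norm ?circ_dist0_ge0// circ_dist0_01; last first.
    by rewrite xk (lt_trans xkq).
  rewrite lt_min gt_min [in X in _ && X]gt_min => /andP[/orP[//|h1] /orP[h2|h2]]; move: h1 h2 xkq; lra.
have incr k : iter N G x <= iter (N + k) G x.
  elim: k => [|k IH]; first by rewrite addn0.
  rewrite addnS iterS (le_trans IH)// ltW// Gy// (andP (Hn _).1).1.
  exact/small/leq_addr.
have xN0 : 0 < iter N G x by case/andP: (Hn N).1.
have : 0 < Num.min (iter N G x) (1 - q) by rewrite lt_min xN0 subr_gt0.
move/cvgrPdist_lt : (cv) => /[apply] -[K _ HK].
have := HK (N + K)%N (leq_addl _ _); have /andP[xk xkq] := (Hn (N + K)%N).1.
have := incr K.
rewrite /= sub0r normrN ger0_norm ?circ_dist0_ge0// circ_dist0_01; last first.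
  by rewrite xk (lt_trans xkq).
rewrite lt_min !gt_min => h0 /andP[/orP[h1|h1] /orP[h2|h2]]; move: h0 h1 h2 xkq; lra.
Qed.

End Basin.

(** * The saddle-node push, the last fixed point and the backward orbit *)

Section SaddleNode.
Variables (R : realType) (G g : R -> R).
Hypothesis dG : forall x : R, is_derive x 1 G (g x).
Hypothesis g_gt0 : forall x, 0 < g x.
Hypothesis G0 : G 0 = 0.

Let cG : continuous G. Proof. exact: (@continuous_iter _ _ _ dG g_gt0 1). Qed.

(** The mean value theorem gives [G y = g c * y] and then [g c - 1 = g2 e * c], with [c] and [e]
    between 0 and [y]; so [G y - y] has the sign of [c * y], positive on both sides. *)
Lemma saddle_node_push (g2 : R -> R) :
  (forall x : R, is_derive x 1 g (g2 x)) -> continuous g2 ->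
  g 0 = 1 -> 0 < g2 0 ->
  exists2 del, 0 < del & forall y, y != 0 -> `|y| < del -> y < G y.
Proof.
move=> dg g2c g01 g20.
have cg : continuous g.
  move=> x; apply/differentiable_continuous/derivable1_diffP.
  by have [] := dg x.
have /nbhs_ballP[del /= del0 H] : \forall x \near (0 : R), 0 < g2 x.
  exact: (cvgr_gt _ (g2c 0)).
exists del => // y y0.
rewrite ltr_norml => /andP[dy yd].
have gpos c : - del < c < del -> 0 < g2 c.
  by move=> /andP[? ?]; apply: H; rewrite -ball_normE/= sub0r normrN ltr_norml; apply/andP.
move: y0; rewrite neq_lt => /orP[y0|y0].
  have [c] := MVT y0 (fun x _ => dG x) (continuous_subspaceT cG).
  rewrite in_itv/= => /andP[yc c0]; rewrite G0 !sub0r => Gy.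
  have [e] := MVT c0 (fun x _ => dg x) (continuous_subspaceT cg).
  rewrite in_itv/= => /andP[ce e0]; rewrite g01 sub0r => ge.
  have g2e : 0 < g2 e * - c.
    rewrite mulr_gt0 ?oppr_gt0// gpos// (lt_trans dy (lt_trans yc ce)).
    exact: lt_trans e0 del0.
  rewrite -ltrN2 Gy gtr_pMl ?oppr_gt0//; move: g2e; rewrite -ge; lra.
have [c] := MVT y0 (fun x _ => dG x) (continuous_subspaceT cG).
rewrite in_itv/= => /andP[c0 cy]; rewrite G0 !subr0 => Gy.
have [e] := MVT c0 (fun x _ => dg x) (continuous_subspaceT cg).
rewrite in_itv/= => /andP[e0 ec]; rewrite g01 subr0 => ge.
have g2e : 0 < g2 e * c.
  rewrite mulr_gt0// gpos// (lt_trans ec (lt_trans cy yd)) andbT.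
  by apply: lt_trans e0; rewrite oppr_lt0.
rewrite Gy ltr_pMl//; move: g2e; rewrite -ge; lra.
Qed.

(** [p] is the supremum of the points of [(-1, 0)] not moved to the right. The push near 0 keeps it
    negative, and continuity excludes both strict inequalities at [p]. *)
Lemma last_fixed_left x0 del : -1 < x0 < 0 -> G x0 <= x0 -> 0 < del ->
  (forall y, - del < y < 0 -> y < G y) ->
  exists p, [/\ -1 < p < 0, G p = p & forall y, p < y < 0 -> y < G y].
Proof.
move=> /andP[x01 x00] Gx0 del0 Gy.
set S := [set x | -1 < x < 0 /\ G x <= x].
have Sx0 : S x0 by split => //; rewrite x01.
have ubS : ubound S (- del).
  move=> x [/andP[x1 x0'] Gx]; rewrite leNgt; apply/negP => dx.
  by have := Gy x; rewrite dx x0' => /(_ isT); rewrite ltNge Gx.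
have hS : has_sup S by split; [exists x0|exists (- del)].
have hub := sup_upper_bound hS.
pose p := sup S; exists p.
have x0p : x0 <= p by exact: hub.
have p0 : p < 0.
  by apply: (@le_lt_trans _ _ (- del)); [exact: (ge_sup hS.1)|rewrite oppr_lt0].
have pm1 : -1 < p by exact: lt_le_trans x0p.
have above y : p < y < 0 -> y < G y.
  move=> /andP[py y0]; rewrite ltNge; apply/negP => Gyy.
  suff /hub : S y by rewrite leNgt py.
  by split => //; rewrite y0 (lt_trans pm1 py).
have ch : continuous (fun y => G y - y).
  by move=> y; apply: cvgB; [exact: cG|exact: cvg_id].
split => //; first by rewrite pm1.
apply/eqP; rewrite eq_le; apply/andP; split; rewrite leNgt; apply/negP => h.
  have /nbhs_ballP[e /= e0 He] : \forall y \near p, 0 < G y - y.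
    by apply: (cvgr_gt _ (ch p)); rewrite subr_gt0.
  have [s Ss ps] := sup_adherent e0 hS.
  have : ball p e s.
    rewrite -ball_normE/= ltr_norml; have := hub _ Ss.
    by move: ps; rewrite -/p => ps sp; rewrite -/p in sp; lra.
  by move=> /He; rewrite /= subr_gt0 ltNge Ss.2.
have /nbhs_ballP[e /= e0 He] : \forall y \near p, G y - y < 0.
  by apply: (cvgr_lt _ (ch p)); rewrite subr_lt0.
pose y := Num.min (p + e / 2) (p / 2).
have py : p < y by rewrite lt_min; apply/andP; split; lra.
have y0 : y < 0 by rewrite gt_min; apply/orP; right; lra.
have : ball p e y.
  have ye : y <= p + e / 2 by rewrite ge_min lexx.
  by rewrite -ball_normE/= ltr_norml; move: py ye e0; lra.
move=> /He; rewrite /= subr_lt0 ltNge => /negP; apply.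
by rewrite ltW// above// py.
Qed.

(** Since [G] moves points of [(0, q]] to the right, each has a preimage to its left. The decreasing
    preimages converge to a fixed point in [[0, q]], hence to 0. *)
Lemma preimage_sequence q : 0 < q -> (forall y, 0 < y <= q -> y < G y) ->
  exists xs : nat -> R, [/\ xs 0%N = q, forall j, G (xs j.+1) = xs j,
    forall j, 0 < xs j, forall j, xs j.+1 < xs j &
    forall e, 0 < e -> exists N, xs N.+1 < e].
Proof.
move=> q0 Gy.
(* The range condition sits under the existential, with witness 0 outside it, so that [choice]
   yields a total function. *)
have ex y : exists z, 0 < y <= q -> [/\ 0 < z, z < y & G z = y].
  have [/andP[y0 yq]|] := boolP (0 < y <= q); last by exists 0.
  have yG := Gy y; rewrite y0 yq in yG; have {}yG := yG isT.
  have [z /andP[z0 zy] /= Gz] : exists2 z, 0 <= z <= y & iter 1 G z = y.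
    by apply: (iter_ivt dG g_gt0 (ltW y0)); rewrite /= G0 (ltW y0) ltW.
  exists z => _; split => //.
    by rewrite lt_neqAle z0 andbT; apply/eqP => z00; move: y0; rewrite -Gz -z00 G0 ltxx.
  by rewrite lt_neqAle zy andbT; apply/eqP => zz; move: yG; rewrite -zz Gz zz ltxx.
have [h hP] := choice ex.
pose xs j := iter j h q.
have xsP j : 0 < xs j <= q.
  elim: j => [|j IH]; first by rewrite /xs/= q0 lexx.
  have [h1 h2 _] := hP _ IH; rewrite /xs/= h1/=.
  by move: IH => /andP[_]; apply: le_trans; exact: ltW.
have xs0 j : 0 < xs j by case/andP: (xsP j).
have xsd j : xs j.+1 < xs j by case: (hP _ (xsP j)).
have Gxs j : G (xs j.+1) = xs j by case: (hP _ (xsP j)).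
exists xs; split => // e e0.
have dec : {homo xs : n m / (n <= m)%N >-> m <= n}.
  by apply/nonincreasing_seqP => j; exact: ltW.
have lb : has_lbound (range xs) by exists 0 => _ [j _ <-]; exact: ltW.
have cv := nonincreasing_cvgn dec lb; set l := inf _ in cv.
have Gl : G l = l by apply: (lim_fixed dG g_gt0 cv); right => k; rewrite Gxs.
have l0 : 0 <= l by apply: lb_le_inf => [|_ [j _ <-]]; [by exists (xs 0%N), 0%N|exact: ltW].
have lq : l <= q by apply: (ge_inf lb); exists 0%N.
have {}l0 : l = 0.
  apply/eqP; rewrite eq_le l0 andbT leNgt; apply/negP => l0'.
  by have := Gy l; rewrite l0' lq Gl ltxx => /(_ isT).
rewrite l0 in cv; move/cvgrPdist_lt : cv => /(_ _ e0)[N _ HN].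
exists N; have /= := HN N.+1 (leqnSn N).
by rewrite sub0r normrN gtr0_norm//; exact: (xs0 N.+1).
Qed.

End SaddleNode.

(** * Uniform constants for the normalised lift *)

Section Null.
Variables (R : realType) (G g g2 : R -> R).
Hypothesis dG : forall x : R, is_derive x 1 G (g x).
Hypothesis g_gt0 : forall x, 0 < g x.
Hypothesis dg : forall x : R, is_derive x 1 g (g2 x).
Hypothesis cg2 : continuous g2.
Variables (dn : nat) (q : R).
Hypothesis Gper : forall x, G (x + 1) = G x + (dn.+2%:Z)%:~R.
Hypothesis G0 : G 0 = 0.
Hypothesis g01 : g 0 = 1.
Hypothesis q_gt0 : 0 < q.
Hypothesis q_lt1 : q < 1.
Hypothesis Gq : G q = q + (dn.+1%:Z)%:~R.
Hypothesis g_gt1 : forall x, 0 < x <= q -> 1 < g x.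

Let g_ge1 x : 0 <= x <= q -> 1 <= g x.
Proof.
move=> /andP[]; rewrite le_eqVlt => /orP[/eqP<-|x0 xq]; first by rewrite g01.
by rewrite ltW// g_gt1// x0.
Qed.

Let cg : continuous g.
Proof.
move=> x; apply/differentiable_continuous/derivable1_diffP.
by have [] := dg x.
Qed.

(** The derivative of [ln g] is [g2 / g]; as [g >= 1] on [[0, q]], the maximum of [|g2|] there
    serves as [L]. *)
Lemma ln_deriv_lip : exists2 L, 0 <= L & forall x y,
  0 <= x <= q -> 0 <= y <= q -> `|ln (g x) - ln (g y)| <= L * `|x - y|.
Proof.
have cabs : {within `[0, q], continuous (fun x => `|g2 x|)}.
  apply: continuous_subspaceT => x.
  by apply: (continuous_comp (@cg2 x)); exact: norm_continuous.
have [c _ cmax] := EVT_max (ltW q_gt0) cabs.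
exists `|g2 c| => // x y hx hy; wlog xy : x y hx hy / y <= x.
  move=> H; have [/H|/ltW/H] := leP y x; first exact.
  by rewrite distrC [`|x - y|]distrC; exact.
have dln (z : R) : is_derive z 1 (@ln R \o g) ((g z)^-1 * g2 z).
  by apply: is_derive1_comp; exact: is_derive1_ln.
have cln : continuous (@ln R \o g).
  move=> z; apply/differentiable_continuous/derivable1_diffP.
  by have [] := dln z.
have [z] := MVT_segment xy (fun z _ => dln z) (continuous_subspaceT cln).
rewrite in_itv/= => /andP[yz zx] ->.
have hz : 0 <= z <= q by move: hx hy; lra.
rewrite !normrM ler_wpM2r// ger0_norm ?invr_ge0 ?(ltW (g_gt0 _))//.
apply: (@le_trans _ _ `|g2 z|); last by apply: cmax; rewrite in_itv.
by rewrite ler_piMl// invf_le1// g_ge1.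
Qed.

Lemma survivors_null : lebesgue_measure (survivors G q `&` `[0, q]) = 0%E.
Proof.
have Gy y : 0 < y <= q -> y < G y.
  move=> /andP[y0 yq].
  have [c] := MVT y0 (fun x _ => dG x)
    (continuous_subspaceT (@continuous_iter _ _ _ dG g_gt0 1)).
  rewrite in_itv/= G0 !subr0 => /andP[c0 cy] ->.
  by rewrite ltr_pMl// g_gt1// c0 ltW// (lt_le_trans cy).
have [xs [xs0 Gxs xs_gt0 xs_dec xs_cvg]] := preimage_sequence dG g_gt0 G0 q_gt0 Gy.
have [L L0 Llip] := ln_deriv_lip.
have x1q : xs 1%N < q by rewrite -[ltRHS]xs0.
(* The inverse of the minimum of [g] on [[xs 1, q]] serves as [kap]; it is below 1 because this
   domain stays away from 0. *)
have [c] := EVT_min (ltW x1q) (continuous_subspaceT cg).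
rewrite in_itv/= => /andP[x1c cq] cmin.
have gc1 : 1 < g c by rewrite g_gt1// cq (lt_le_trans (xs_gt0 1%N)).
(* [G] maps [[xs 1, q]] onto [[q, q + dn + 1]], which contains 1. *)
have [e /andP[x1e eq] /= Ge] : exists2 e, xs 1%N <= e <= q & iter 1 G e = 1.
  apply: (iter_ivt dG g_gt0 (ltW x1q)); rewrite /= Gxs xs0 Gq (ltW q_lt1)/=.
  have dn0 : 0 <= dn%:~R :> R by rewrite ler0z.
  by rewrite intS intrD; move: dn0 q_gt0; lra.
have kapg x : xs 1%N <= x <= q -> 1 <= (g c)^-1 * g x.
  by move=> hx; rewrite mulrC ler_pdivlMr// mul1r cmin// in_itv.
apply: (measure_survivors (e1 := e) (kap := (g c)^-1) dG g_gt0 Gper q_gt0 Gq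
  xs0 Gxs xs_gt0 xs_dec xs_cvg _ _ Ge _ _
  (expand_return dG g_gt0 xs0 Gxs xs_gt0 xs_dec g_ge1 kapg)
  (return_logder_lip dG g_gt0 xs0 Gxs xs_gt0 xs_dec L0 g_ge1 Llip)).
- rewrite lt_neqAle x1e andbT; apply/eqP => x1e'.
  by move: q_lt1; rewrite -xs0 -Gxs x1e' Ge ltxx.
- rewrite lt_neqAle eq andbT; apply/eqP => eq'.
  move: Ge; rewrite eq' Gq intS intrD.
  have : 0 <= dn%:~R :> R by rewrite ler0z.
  by move: q_gt0; lra.
- by rewrite invf_lt1.
- by rewrite addr_ge0// mulr_ge0 ?(ltW q_gt0)// D0_ge0.
Qed.

End Null.

(** * Normalisation of the lift and reduction to the survivors *)

Theorem theorem2p1 (R : realType) (F : R -> R) :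
  circle_lift F ->
  C2 F ->
  (forall x, derive1 F x != 0) ->
  (* 0 is a saddle-node fixed point *)
  is_int (F 0) -> derive1 F 0 = 1 -> 0 < derive1n 2 F 0 ->
  (* it is the unique saddle-node fixed point on M *)
  (forall x, is_int (F x - x) -> derive1 F x = 1 -> 0 < derive1n 2 F x -> is_int x) ->
  (* expansion outside W_0 *)
  (forall x, ~ W0 F x -> 1 < `|derive1 F x|) ->
  lebesgue_measure ([set x : R | 0 <= x < 1] `\` basin0 F) = 0%E.
Proof.
move=> [d Fper] [dF [ddF cg2]] F'neq0 [n0 F0] g01 g20 _ HW.
set g := derive1 F in F'neq0 ddF g01 HW *.
set g2 := derive1n 2 F in cg2 g20 *.
have dg (x : R) : is_derive x 1 g (g2 x).
  apply: DeriveDef; first exact: ddF.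
  by rewrite -derive1E.
have cg : continuous g.
  by move=> x; exact/differentiable_continuous/derivable1_diffP.
(* A continuous derivative without zeros and equal to 1 at 0 is positive. *)
have g_gt0 x : 0 < g x.
  rewrite lt_neqAle eq_sym F'neq0/= leNgt; apply/negP => gx.
  have [x0|x0] := leP x 0.
    have [c _ gc] : exists2 c, c \in `[x, 0] & g c = 0.
      apply: (IVT x0 (continuous_subspaceT cg)).
      by rewrite g01 min_l ?max_r ?ltW// (lt_trans gx).
    by have := F'neq0 c; rewrite gc eqxx.
  have [c _ gc] : exists2 c, c \in `[0, x] & g c = 0.
    apply: (IVT (ltW x0) (continuous_subspaceT cg)).
    by rewrite g01 min_r ?max_l ?ltW// (lt_trans gx).
  by have := F'neq0 c; rewrite gc eqxx.
pose G x := F x - n0%:~R.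
have FE : F = (fun x => G x + n0%:~R) by apply/funext => x; rewrite /G subrK.
have G0 : G 0 = 0 by rewrite /G F0 subrr.
have Gper x : G (x + 1) = G x + d%:~R by rewrite /G Fper addrAC.
have dG (x : R) : is_derive x 1 G (g x).
  have h : is_derive x 1 F (g x) by apply: DeriveDef => //; rewrite -derive1E.
  by rewrite -[g x]subr0; apply: is_deriveB.
have BE : basin0 F = basin0 G by rewrite FE (basin0_translate Gper).
have WE : W0 F = W0 G by rewrite /W0 BE.
rewrite BE; rewrite WE in HW.
have [del del0 Gdel] := saddle_node_push dG g_gt0 G0 dg cg2 g01 g20.
have [[x0 [x01 Gx0]]|noS] := pselect (exists x0, -1 < x0 < 0 /\ G x0 <= x0); last first.
  rewrite (_ : _ `\` _ = set0) ?measure0//; apply/seteqP; split => // x [/= /andP[x0 x1]].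
  apply; have left y : -1 < y <= 0 -> basin0 G y.
    apply: (left_basin0 dG g_gt0 G0) => z hz; rewrite ltNge.
    by apply/negP => Gzz; apply: noS; exists z.
  move: x0; rewrite le_eqVlt => /orP[/eqP <-|x0].
    by apply: left; rewrite lexx andbT oppr_lt0.
  by apply/(basin0_int Gper _ (-1)); apply: left; lra.
have [p [/andP[p1 p0] Gp Gleft]] : exists p, [/\ -1 < p < 0, G p = p &
    forall y, p < y < 0 -> y < G y].
  apply: (last_fixed_left dG g_gt0 x01 Gx0 del0) => y /andP[dy y0].
  by apply: Gdel; rewrite ?lt_eqF// ltr0_norm//; lra.
pose q := p + 1.
have q01 : 0 < q < 1 by rewrite /q; lra.
have /andP[q0 q1] := q01.
have Gq : G q = q + (d - 1)%:~R by rewrite /q Gper Gp intrD; lra.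
have g_gt1 x : 0 < x <= q -> 1 < g x.
  move=> hx; rewrite -[g x]gtr0_norm//; apply: HW.
  apply: (right_not_W0 dG g_gt0 Gper q01 Gq G0 del0 _ hx) => y /andP[y0 yd].
  by apply: Gdel; rewrite ?gt_eqF// gtr0_norm.
(* Expansion on [(0, q]] gives [q < G q = q + (d - 1)], so the degree is at least 2. *)
have [dn ddn] : exists dn : nat, d = dn.+2%:Z.
  have [c] := MVT q0 (fun x _ => dG x)
    (continuous_subspaceT (@continuous_iter _ _ _ dG g_gt0 1)).
  rewrite in_itv/= G0 !subr0 => /andP[c0 cq] Gqq.
  have : q < G q by rewrite Gqq ltr_pMl// g_gt1// c0 ltW.
  rewrite Gq ltrDl ltr0z subr_gt0.
  by case: (d) => [[|[|n]]|n]// _; exists n.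
have Lsub : [set x : R | 0 <= x < 1] `\` basin0 G `<=` survivors G q `&` `[0, q].
  move=> x [/= /andP[x_ge0 x1] xB].
  have S : survivors G q x.
    (* Translation by [- m - 1] carries the gap [(m + q, m + 1)] to [(p, 0)], which lies in the
       basin. *)
    move=> n m /andP[h1 h2]; apply: xB; apply/(basin0_iter _ n).
    apply/(basin0_int Gper _ (- m - 1)); apply: (left_basin0 dG g_gt0 G0 Gleft).
    by move: h1 h2; rewrite !(intrD, mulrNz) /q; lra.
  split => //=; rewrite in_itv/= x_ge0/= leNgt; apply/negP => qx.
  by apply: (S 0%N 0); rewrite /= !add0r qx.
have null : lebesgue_measure (survivors G q `&` `[0, q]) = 0%E.
  apply: (survivors_null (dn := dn) dG g_gt0 dg cg2 _ G0 g01 q0 q1 _ g_gt1).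
    by rewrite -ddn.
  by rewrite Gq ddn; congr (_ + _%:~R); rewrite intS addrC addKr.
(* [lebesgue_measure] is an outer measure, monotone on arbitrary sets, so the
   measurability of the basin plays no role. *)
apply/eqP; rewrite eq_le measure_ge0 andbT -null.
exact: le_mu_ext.
Qed.
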